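(* Let $D:\mathbb{R}^m\times\mathbb{R}^m\to\mathbb{R}$ be a smooth data fidelity function, $A\in\mathbb{R}^{m\times n}$ a linear operator, and $f:\mathbb{R}^n\to\mathbb{R}\cup\{\infty\}$ a convex piecewise linear function. If $\dim(\operatorname{dom}(f))=n$, then $\#S^D_{A,f}(b)=1$ for all $b\in\mathbb{R}^m$ if and only if (for $F\in\mathcal{F}_f$) $\operatorname{row}(A)\cap\partial f_F\neq\emptyset$ implies $\operatorname{codim}(\partial f_F)\leq\operatorname{rank}(A)$. That is, every accessible set $F$ must satisfy $\operatorname{codim}(\partial f_F)\leq\operatorname{rank}(A)$.
   Context: $D:\mathbb{R}^m\times\mathbb{R}^m\to\mathbb{R}$ is called a smooth data fidelity function if $z\mapsto D(z,b)$ is strictly convex and differentiable for all $b\in\mathbb{R}^m$, and the map $b\mapsto\nabla_zD(z,b)$, $\mathbb{R}^m\to\mathbb{R}^m$, is bijective for all $z\in\mathbb{R}^m$, where $\nabla_z D$ is the gradient with respect to the first variable. The solution map is $S^D_{A,f}(b):=\operatorname*{argmin}_{x\in\mathbb{R}^n}\{D(Ax,b)+f(x)\}\subseteq\mathbb{R}^n$, and $\#$ denotes cardinality. A set is polyhedral if it is of the form $\{x : v_i^Tx\le w_i,\ i=1,\dots,k\}$ (finite intersection of halfspaces). A function $f:\mathbb{R}^n\to\mathbb{R}\cup\{\infty\}$ is convex piecewise linear if its epigraph $\operatorname{epi}(f)=\{(x,t)\in\mathbb{R}^n\times\mathbb{R}: f(x)\le t\}$ is a polyhedral set; $\operatorname{dom}(f)=\{x: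 f(x)<\infty\}$ is its effective domain. The lower faces of $\operatorname{epi}(f)$ are $\bar{\mathcal{F}}_f:=\{\bar F \text{ is a face of } \operatorname{epi}(f) : \bar F\neq\emptyset \text{ and } \dim(\bar F)\neq n+1\}$, and the primal complex of $f$ is $\mathcal{F}_f:=\{P\bar F : \bar F\in\bar{\mathcal{F}}_f\}$, where $P(x,t)=x$. The subdifferential is $\partial f(x)=\{v\in\mathbb{R}^n : f(y)\ge f(x)+v^T(y-x)\text{ for all }y\in\mathbb{R}^n\}$; for $F\in\mathcal{F}_f$, $\partial f_F$ denotes the constant subdifferential corresponding to the relative interior of $F$, i.e. $\partial f_F=\partial f(x)$ for $x\in\operatorname{relint}(F)$. A set $F\in\mathcal{F}_f$ is called accessible if $F\subseteq\operatorname{range}(S^D_{A,f})$ (the set of all points lying in $S^D_{A,f}(b)$ for some $b\in\mathbb{R}^m$), equivalently if $\operatorname{row}(A)\cap\partial f_F\neq\emptyset$. $\operatorname{row}(A)$ is the row space of $A$; $\operatorname{codim}(C)=n-\dim(C)$, where the dimension of a convex set is that of its affine hull.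
   Formalization: ''#S(b)=1 for all b'' is stated only for those b with S(b) nonempty, since existence of minimizers does not follow: with m=n=1, A=0, D(z,b)=(z-b)^2, f(x)=x, the codimension condition holds vacuously but S(b) is empty for every b. *)

(* Defs.v *)
From HB Require Import structures.
From mathcomp Require Import all_boot all_order all_algebra.
From mathcomp Require Import all_classical all_reals all_analysis.

Set Implicit Arguments.
Unset Strict Implicit.
Unset Printing Implicit Defensive.

Import Order.TTheory GRing.Theory Num.Theory.
Import numFieldNormedType.Exports.

Local Open Scope classical_set_scope.
Local Open Scope ring_scope.

Section ConvexGeometry.
Context {R : realType}.

Definition dot {k : nat} (u v : 'cV[R]_k) : R := (u^T *m v) 0 0.

Definition affine_hull {k : nat} (C : set 'cV[R]_k) : set 'cV[R]_k :=
  [set x | exists (r : nat) (l : 'I_r -> R) (p : 'I_r -> 'cV[R]_k),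
     [/\ forall i, C (p i), \sum_i l i = 1 & x = \sum_i l i *: p i]].

(* For nonempty [C] this is the linear subspace parallel to [affine_hull C]. *)
Definition direction {k : nat} (C : set 'cV[R]_k) : set 'cV[R]_k :=
  [set v | exists x y, [/\ affine_hull C x, affine_hull C y & v = x - y]].

(* Integer-valued so that the empty set can have dimension -1; in particular
   [affine_dim C = n] with [n = 0] forces [C] to be nonempty. *)
Definition affine_dim {k : nat} (C : set 'cV[R]_k) : int :=
  if `[< C = set0 >] then -1
  else (\dim (xget 0%VS [set V : {vspace 'cV[R]_k} |
                           forall v, v \in V <-> direction C v]))%:Z.

Definition affine_codim {k : nat} (C : set 'cV[R]_k) : int :=
  k%:Z - affine_dim C.

Definition relint {k : nat} (C : set 'cV[R]_k) : set 'cV[R]_k :=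
  [set x | C x /\ \forall y \near x, affine_hull C y -> C y].

Definition polyhedral {k : nat} (C : set 'cV[R]_k) : Prop :=
  exists (r : nat) (v : 'I_r -> 'cV[R]_k) (w : 'I_r -> R),
    C = [set x | forall i, dot (v i) x <= w i].

(* Faces are cut out by valid inequalities; [c = 0] gives [C] itself and the
   empty face. *)
Definition face {k : nat} (C F : set 'cV[R]_k) : Prop :=
  exists (c : 'cV[R]_k) (d : R),
    (forall x, C x -> dot c x <= d) /\ F = C `&` [set x | dot c x = d].

End ConvexGeometry.

Section PiecewiseLinear.
Context {R : realType} {n : nat}.
Implicit Types (f : 'cV[R]_n -> \bar R) (F : set 'cV[R]_n).

Definition effective_domain f : set 'cV[R]_n := [set x | (f x < +oo)%E].

(* R^n x R is represented by 'cV[R]_(n + 1), the pair (x, t) being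
   [col_mx x t%:M]; the projection (x, t) |-> x is [usubmx]. *)
Definition epi f : set 'cV[R]_(n + 1) :=
  [set p | (f (usubmx p) <= (dsubmx p 0 0)%:E)%E].

Definition convex_piecewise_linear f : Prop :=
  (forall x, f x != -oo%E) /\ polyhedral (epi f).

Definition lower_face f (Fbar : set 'cV[R]_(n + 1)) : Prop :=
  [/\ face (epi f) Fbar, Fbar !=set0 & affine_dim Fbar <> (n + 1)%N%:Z].

Definition primal_complex f : set (set 'cV[R]_n) :=
  [set F | exists2 Fbar, lower_face f Fbar & F = usubmx @` Fbar].

Definition subdifferential f (x : 'cV[R]_n) : set 'cV[R]_n :=
  [set v | forall y, (f x + (dot v (y - x))%:E <= f y)%E].

(* The subdifferential at a chosen point of the relative interior of [F]; the
   choice is immaterial whenever [subdifferential f] is constant there. *)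
Definition face_subdifferential f F : set 'cV[R]_n :=
  subdifferential f (get (relint F)).

End PiecewiseLinear.

Section DataFidelity.
Context {R : realType} {m : nat}.

Definition strictly_convex (g : 'cV[R]_m -> R) : Prop :=
  forall (x y : 'cV[R]_m) (t : R), x != y -> 0 < t < 1 ->
    g (t *: x + (1 - t) *: y) < t * g x + (1 - t) * g y.

Definition gradient (g : 'cV[R]_m -> R) (z : 'cV[R]_m) : 'cV[R]_m :=
  \col_i 'D_(delta_mx i 0) g z.

Definition smooth_data_fidelity (D : 'cV[R]_m -> 'cV[R]_m -> R) : Prop :=
  (forall b, strictly_convex (D ^~ b) /\
             forall z, differentiable (D ^~ b) z) /\
  (forall z, bijective (fun b => gradient (D ^~ b) z)).

End DataFidelity.

Section Regression.
Context {R : realType} {m n : nat}.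
Implicit Types (D : 'cV[R]_m -> 'cV[R]_m -> R) (A : 'M[R]_(m, n)).

Definition row_space A : set 'cV[R]_n := [set v | (v^T <= A)%MS].

Definition solution_map D A (f : 'cV[R]_n -> \bar R) (b : 'cV[R]_m) :
    set 'cV[R]_n :=
  [set x | forall y, ((D (A *m x) b)%:E + f x <= (D (A *m y) b)%:E + f y)%E].

Definition accessible D A (f : 'cV[R]_n -> \bar R) (F : set 'cV[R]_n) : Prop :=
  F `<=` [set x | exists b, solution_map D A f b x].

End Regression.

(* Main.v *)
(* By Fermat's rule, x solves the problem for some b exactly when row(A) meets
   G, the subdifferential of f at x. For u in row(A), call {z : u is a
   subgradient of f at z} the contact set of u; its points with a given image
   under A are exactly the solutions for a suitable b.
   If u is in G and row(A), and codim G > rank A, some nonzero direction lies in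
   ker A and is orthogonal to the affine hull of G. By polyhedrality, moving x
   a little along it keeps x in the contact set of u: a second solution.
   Conversely, if solutions are not unique, some u in row(A) has a contact set
   containing two points with the same image under A. Take such a u with contact
   set of maximal dimension, and x in the relative interior of that set. As
   codim G <= rank A, the direction space of G meets row(A) in some e <> 0. Since
   dom f has full dimension, G contains no line, so u + t e (or u - t e) leaves G
   after a last point u'. By Farkas' lemma the contact set of u' contains that of
   u and has larger dimension, a contradiction. *)
Require Import Defs.
From HB Require Import structures.
From mathcomp Require Import all_boot all_order all_algebra.
From mathcomp Require Import all_classical all_reals all_analysis.
From mathcomp Require Import ring lra.
Set Implicit Arguments.
Unset Strict Implicit.
Import Order.TTheory GRing.Theory Num.Theory.
Import numFieldNormedType.Exports.
Local Open Scope classical_set_scope.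
Local Open Scope ring_scope.

(** * Inner product on column vectors *)

Section Dot.
Context {R : realType} {k : nat}.
Implicit Types u v w : 'cV[R]_k.

Lemma dotE u v : dot u v = \sum_i u i 0 * v i 0.
Proof. by rewrite /dot mxE; apply: eq_bigr => i _; rewrite mxE. Qed.

Lemma dotC u v : dot u v = dot v u.
Proof. by rewrite !dotE; apply: eq_bigr => i _; rewrite mulrC. Qed.

Lemma dotDr u v w : dot u (v + w) = dot u v + dot u w.
Proof. by rewrite /dot mulmxDr mxE. Qed.

Lemma dotZr u (a : R) v : dot u (a *: v) = a * dot u v.
Proof. by rewrite /dot -scalemxAr mxE. Qed.

Lemma dotNr u v : dot u (- v) = - dot u v.
Proof. by rewrite /dot mulmxN mxE. Qed.

Lemma dotDl u v w : dot (v + w) u = dot v u + dot w u.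
Proof. by rewrite !(dotC _ u) dotDr. Qed.

Lemma dotZl u (a : R) v : dot (a *: v) u = a * dot v u.
Proof. by rewrite !(dotC _ u) dotZr. Qed.

Lemma dotNl u v : dot (- v) u = - dot v u.
Proof. by rewrite !(dotC _ u) dotNr. Qed.

Lemma dot0r u : dot u 0 = 0.
Proof. by rewrite -[0](scale0r 0) dotZr mul0r. Qed.

Lemma dot0l u : dot 0 u = 0.
Proof. by rewrite dotC dot0r. Qed.

Lemma dot_suml (I : Type) (s : seq I) (p : I -> 'cV[R]_k) u :
  dot (\sum_(i <- s) p i) u = \sum_(i <- s) dot (p i) u.
Proof.
by apply: (big_morph (fun v => dot v u)) => [v w|]; rewrite ?dotDl ?dot0l.
Qed.

Lemma dotvv_eq0 u : dot u u = 0 -> u = 0.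
Proof.
rewrite dotE => /eqP; rewrite psumr_eq0 => [/allP uu0|i _]; last exact: sqr_ge0.
apply/colP => i; rewrite mxE.
by have /(_ (mem_index_enum i)) := uu0 i; rewrite /= mulf_eq0 orbb => /eqP.
Qed.

Definition dotr := (dotDr, dotNr, dotZr, dotDl, dotNl, dotZl).

Lemma dot_mulmxl (l : nat) (M : 'M[R]_(l, k)) (x : 'cV[R]_l) u :
  dot (M^T *m x) u = dot x (M *m u).
Proof. by rewrite /dot trmx_mul trmxK mulmxA. Qed.

End Dot.

(* Bartl's induction: a constraint violated at a point [x0] satisfying the
   others is eliminated by projecting along [x0]. *)
Lemma farkas (R : realType) (k r : nat) (p : 'I_r -> 'cV[R]_k) (e : 'cV[R]_k) :
  (forall x, (forall i, dot (p i) x <= 0) -> dot e x <= 0) ->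
  exists l : 'I_r -> R, (forall i, 0 <= l i) /\ e = \sum_i l i *: p i.
Proof.
elim: r p e => [|r IHr] p e He.
  (* With no constraints, testing at [e] itself gives [dot e e <= 0]. *)
  exists (fun _ => 0); split => //; rewrite big_ord0.
  apply: dotvv_eq0; apply/eqP; rewrite eq_le He => [|[]//].
  by rewrite dotE sumr_ge0// => i _; exact: sqr_ge0.
have widenE (i : 'I_r) : widen_ord (leqnSn r) i = lift ord_max i.
  by apply: val_inj; rewrite /= /bump leqNgt ltn_ord add0n.
pose p' i := p (lift ord_max i).
have [|/existsNP[x0 /not_implyP[Hx0 /negP]]] :=
    pselect (forall x, (forall i, dot (p' i) x <= 0) -> dot e x <= 0).
  move=> /IHr[l [l0 ->]].
  exists (fun i => if unlift ord_max i is Some j then l j else 0).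
  split=> [i|]; first by case: unliftP.
  rewrite big_ord_recr /= unlift_none scale0r addr0; apply: eq_bigr => i _.
  by rewrite widenE liftK.
rewrite -ltNge => ex0.
have px0 : 0 < dot (p ord_max) x0.
  rewrite ltNge; apply/negP => px0; move: ex0; rewrite ltNge => /negP; apply.
  apply: He => i; case: (unliftP ord_max i) => [j ->|->//]; exact: Hx0.
pose c := (dot (p ord_max) x0)^-1.
(* [proj] is the adjoint of the projection along [x0] onto the hyperplane orthogonal to
   [p ord_max]. *)
pose proj u := u - (c * dot u x0) *: p ord_max.
have projE u x : dot (proj u) x = dot u (x - (c * dot (p ord_max) x) *: x0).
  by rewrite /proj !dotr; ring.
have [x|l [l0 El]] := IHr (proj \o p') (proj e).
  move=> Hx; rewrite projE; apply: He => i.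
  case: (unliftP ord_max i) => [j ->|->]; first by rewrite -projE; exact: Hx.
  by rewrite !dotr mulrAC mulVf ?gt_eqF// mul1r subrr.
(* The corrections made by [proj] add up to the last coefficient. It is nonnegative because [e] is
   positive and every [p'] nonpositive at [x0]. *)
exists (fun i => if unlift ord_max i is Some j then l j
  else c * dot e x0 - \sum_j l j * (c * dot (p' j) x0)).
split=> [i|].
  case: unliftP => // _; rewrite subr_ge0 (@le_trans _ _ 0)//.
    apply: sumr_le0 => j _; apply: mulr_ge0_le0 => //; apply: mulr_ge0_le0 => //.
    by rewrite invr_ge0 ltW.
  by rewrite mulr_ge0 ?invr_ge0 ?ltW.
rewrite big_ord_recr /= unlift_none.
rewrite (eq_bigr (fun i => l i *: p' i)); last first.
  by move=> i _; rewrite widenE liftK.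
move: El => /(canRL (subrK _)).
rewrite (eq_bigr (fun i => l i *: p' i - (l i * (c * dot (p' i) x0)) *: p ord_max)).
  rewrite big_split /= sumrN -scaler_suml scalerBl.
  by move=> Ee; rewrite [LHS]Ee -!addrA; congr (_ + _); rewrite addrC.
by move=> i _; rewrite /= /proj scalerBr scalerA.
Qed.

(** * Affine hulls and relative interiors *)

Section AffineHull.
Context {R : realType} {k : nat}.
Implicit Types (C : set 'cV[R]_k) (x y v : 'cV[R]_k).

Lemma dot_continuous v : continuous (dot v).
Proof.
move=> x; suff H (s : seq 'I_k) :
    {for x, continuous (fun y => \sum_(i <- s) v i 0 * y i 0)}.
  rewrite (_ : dot v = fun y => \sum_i v i 0 * y i 0); first exact: H.
  by apply/funext => y; exact: dotE.
elim: s => [|i s IHs].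
  rewrite (_ : (fun y => _) = cst 0); first exact: cst_continuous.
  by apply/funext => y; rewrite big_nil.
rewrite (_ : (fun y => _) =
    (fun y => v i 0 * y i 0 + \sum_(j <- s) v j 0 * y j 0)); last first.
  by apply/funext => y; rewrite big_cons.
apply: continuousD => //; apply: continuousM; first exact: cst_continuous.
exact: coord_continuous.
Qed.

Lemma dot_coll (j : nat) (P : 'M[R]_(k, j)) i v :
  dot (col i P) v = (v^T *m P) 0 i.
Proof. by rewrite dotC /dot colE mulmxA -colE mxE. Qed.

Lemma affine_hull_sub C : C `<=` affine_hull C.
Proof.
move=> x Cx; exists 1, (fun=> 1), (fun=> x); split => //.
  by rewrite big_ord1.
by rewrite big_ord1 scale1r.
Qed.

(** A linearly independent family of differences with [x0] of maximal length spans all of them. As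
    its rows come from points of [C], later orthogonality claims can be checked on [C] alone. *)
Lemma affine_hull_basis C x0 : C x0 ->
  exists (j : nat) (M : 'M[R]_(j, k)), [/\ row_free M,
    forall i, C (x0 + (row i M)^T) &
    forall x, affine_hull C x <-> ((x - x0)^T <= M)%MS].
Proof.
move=> Cx0.
pose P j := `[< exists M : 'M[R]_(j, k),
  row_free M /\ forall i, C (x0 + (row i M)^T) >].
have P0 : exists j, P j.
  exists 0; apply/asboolP; exists 0; split=> [|[]//].
  by rewrite /row_free mxrank0.
have Pk j : P j -> (j <= k)%N.
  by move=> /asboolP[M [/eqP Mj _]]; rewrite -Mj; exact: rank_leq_col.
case: (ex_maxnP P0 Pk) => j /asboolP[M [Mfree CM]] jmax.
exists j, M; split => //.
have CsubM x : C x -> ((x - x0)^T <= M)%MS.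
  move=> Cx; apply/negP => /negP xM.
  suff /jmax : P (j + 1)%N by rewrite addn1 ltnn.
  apply/asboolP; exists (col_mx M (x - x0)^T); split=> [|i].
    rewrite /row_free eqn_leq rank_leq_row/= -{1}(eqP Mfree) addn1.
    apply: rank_ltmx; rewrite ltmxE col_mx_sub (negbTE xM) andbF andbT.
    by rewrite -addsmxE addsmxSl.
  case: (split_ordP i) => i' ->.
    by rewrite rowKu.
  by rewrite rowKd row_id trmxK addrC subrK.
move=> x; split=> [[r [l [p [Cp l1 ->]]]]|].
  have -> : \sum_i l i *: p i - x0 = \sum_i l i *: (p i - x0).
    under [RHS]eq_bigr do rewrite scalerBr.
    by rewrite sumrB -scaler_suml l1 scale1r.
  rewrite raddf_sum /=; apply: summx_sub => i _; rewrite linearZ /=.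
  exact/scalemx_sub/CsubM.
move=> /submxP[c Ec].
(* The point [x0], at index [ord0], takes the weight missing from 1. *)
exists j.+1, (fun i => if unlift ord0 i is Some j then c 0 j else 1 - \sum_j c 0 j).
exists (fun i => if unlift ord0 i is Some j then x0 + (row j M)^T else x0).
split=> [i||]; first by case: unliftP.
  rewrite big_ord_recl unlift_none; under [X in _ + X]eq_bigr do rewrite liftK.
  by rewrite subrK.
rewrite big_ord_recl unlift_none.
under [X in _ + X]eq_bigr do rewrite liftK scalerDr.
rewrite big_split /= -scaler_suml addrA -scalerDl subrK scale1r.
apply/eqP; rewrite addrC -subr_eq; apply/eqP.
rewrite -[LHS]trmxK Ec mulmx_sum_row raddf_sum; apply: eq_bigr => i _ /=.
by rewrite linearZ.
Qed.

Lemma affine_dim_rank C x0 j (M : 'M[R]_(j, k)) : C x0 ->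
  (forall x, affine_hull C x <-> ((x - x0)^T <= M)%MS) ->
  affine_dim C = (\rank M)%:Z.
Proof.
move=> Cx0 hullM; rewrite /affine_dim; case: ifPn => [/asboolP C0|_].
  by move: Cx0; rewrite C0.
have dirE v : direction C v <-> (v^T <= M)%MS.
  split=> [[x [y [/hullM Hx /hullM Hy ->]]]|Hv].
    have -> : x - y = (x - x0) - (y - x0) by rewrite opprB addrA subrK.
    by rewrite linearB /= addmx_sub// -scaleN1r scalemx_sub.
  exists (x0 + v), x0; split; last by rewrite addrC addKr.
    by apply/hullM; rewrite addrC addKr.
  by apply/hullM; rewrite subrr trmx0 sub0mx.
(* The row space of [M] as a subspace of column vectors; [row_base] makes the parametrization
   injective, so the dimension is the rank. *)
pose phi := linfun (trmx \o mulmxr (row_base M)) : 'Hom('rV[R]_(\rank M), 'cV[R]_k).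
have VP v : v \in limg phi <-> direction C v.
  split=> [/memv_imgP[u _ ->]|/dirE].
    by apply/dirE; rewrite lfunE /= trmxK -(eq_row_base M) submxMl.
  rewrite -(eq_row_base M) => /submxP[u Eu]; apply/memv_imgP; exists u.
    exact: memvf.
  by rewrite lfunE /= -Eu trmxK.
rewrite (xget_subset1 _ (x := limg phi))//; last first.
  move=> U V HU HV; apply/vspaceP => v; apply/idP/idP.
    by move=> /(HU v) /(HV v).
  by move=> /(HV v) /(HU v).
rewrite limg_dim_eq; first by rewrite dimvf dim_matrix mul1r.
apply/eqP; rewrite capfv; apply/lker0P => u1 u2; rewrite !lfunE /=.
by move/trmx_inj; apply: row_free_inj; exact: row_base_free.
Qed.

Definition convex_closed C := forall x y (t : R),
  C x -> C y -> 0 <= t <= 1 -> C (t *: x + (1 - t) *: y).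

Lemma convex_sum C r (l : 'I_r -> R) (p : 'I_r -> 'cV[R]_k) :
  convex_closed C -> (forall i, C (p i)) -> (forall i, 0 <= l i) ->
  \sum_i l i = 1 -> C (\sum_i l i *: p i).
Proof.
move=> convC; elim: r l p => [|r IHr] l p Cp l0.
  by rewrite big_ord0 => /esym/eqP; rewrite oner_eq0.
rewrite !big_ord_recl => l1.
have [l_1|l_1] := eqVneq (l ord0) 1.
  have /eqP : \sum_(i < r) l (lift ord0 i) = 0.
    by move: l1; rewrite l_1 -[RHS]addr0 => /addrI.
  rewrite psumr_eq0// => /allP ll0.
  rewrite big1 ?addr0 ?l_1 ?scale1r// => i _.
  by have /(_ (mem_index_enum i))/eqP -> := ll0 i; rewrite scale0r.
have s1 : \sum_(i < r) l (lift ord0 i) = 1 - l ord0.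
  by rewrite -l1 addrC addKr.
have l_lt1 : 0 < 1 - l ord0.
  by rewrite lt_neqAle -s1 sumr_ge0// andbT s1 eq_sym subr_eq0 eq_sym.
have -> : \sum_(i < r) l (lift ord0 i) *: p (lift ord0 i) = (1 - l ord0) *:
    \sum_(i < r) (l (lift ord0 i) / (1 - l ord0)) *: p (lift ord0 i).
  rewrite scaler_sumr; apply: eq_bigr => i _.
  by rewrite scalerA mulrC divfK// gt_eqF.
apply: convC => //; last by rewrite l0 -subr_ge0 ltW.
apply: IHr => [//|i|]; first by rewrite divr_ge0// ltW.
by rewrite -mulr_suml s1 divff// gt_eqF.
Qed.

(** [C] contains a simplex of full dimension in its affine hull, with vertices [x0] and
    [x0 + (row i M)^T]. All barycentric coordinates are positive at the barycentre [b], hence also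
    near it. *)
Lemma relint_nonempty C : convex_closed C -> C !=set0 -> relint C !=set0.
Proof.
move=> convC [x0 Cx0].
have [j [M [Mfree CM hullM]]] := affine_hull_basis Cx0.
pose a : R := (j.+1%:R)^-1.
have a0 : 0 < a by rewrite invr_gt0 ltr0n.
(* [g] and [g0] extend the barycentric coordinates to continuous functions on the whole space;
   [pinvmx M] reads off coordinates in the rows of [M]. *)
pose g (i : 'I_j) x := dot (col i (pinvmx M)) (x - x0).
pose g0 x := 1 - dot (\sum_i col i (pinvmx M)) (x - x0).
have simplexP x : affine_hull C x -> (forall i, 0 <= g i x) -> 0 <= g0 x -> C x.
  move=> /hullM xM g_ge0 g0_ge0.
  have gE i : ((x - x0)^T *m pinvmx M) 0 i = g i x.
    by rewrite /g dot_coll.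
  have -> : x = \sum_(i < j.+1)
      (if unlift ord0 i is Some i' then g i' x else g0 x) *:
      (if unlift ord0 i is Some i' then x0 + (row i' M)^T else x0).
    rewrite big_ord_recl unlift_none.
    under [X in _ + X]eq_bigr do rewrite liftK scalerDr.
    rewrite big_split /= -scaler_suml addrA -scalerDl /g0 dot_suml subrK scale1r.
    apply/eqP; rewrite addrC -subr_eq; apply/eqP.
    rewrite -[LHS]trmxK -(mulmxKpV xM) mulmx_sum_row raddf_sum.
    by apply: eq_bigr => i _ /=; rewrite linearZ /= gE.
  apply: convex_sum => //.
  - by move=> i; case: unliftP.
  - by move=> i; case: unliftP.
  - rewrite big_ord_recl unlift_none; under [X in _ + X]eq_bigr do rewrite liftK.
    by rewrite /g0 dot_suml subrK.
pose b := x0 + (const_mx a *m M)^T.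
have gb i : g i b = a.
  rewrite /g dot_coll /b [x0 + _]addrC addrK trmxK.
  by rewrite (mulmxKp Mfree) !mxE.
have g0b : g0 b = a.
  rewrite /g0 dot_suml (eq_bigr (fun=> a)) => [|i _]; last exact: gb.
  apply/eqP; rewrite sumr_const card_ord subr_eq -mulrS -mulr_natr.
  by rewrite /a mulVf// pnatr_eq0.
have g_cont i : {for b, continuous (g i)}.
  apply: continuous_comp; last exact: dot_continuous.
  by apply: continuousB => //; exact: cst_continuous.
have g0_cont : {for b, continuous g0}.
  apply: continuousB; first exact: cst_continuous.
  apply: continuous_comp; last exact: dot_continuous.
  by apply: continuousB => //; exact: cst_continuous.
have bhull : affine_hull C b.
  by apply/hullM; rewrite /b [x0 + _]addrC addrK trmxK submxMl.
exists b; split; first by apply: simplexP => // [i|]; rewrite ?gb ?g0b ltW.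
have near_g0 : \forall x \near b, 0 < g0 x.
  by have /cvgr_gt := g0_cont; apply; rewrite g0b.
have near_g : \forall x \near b, forall i, 0 < g i x.
  apply: (@filter_forall _ _ (fun i => [set x | 0 < g i x]) (nbhs b)) => i.
  by have /cvgr_gt := g_cont i; apply; rewrite gb.
near=> x => xhull; apply: simplexP => // [i|]; apply: ltW.
  by move: i; near: x.
by near: x.
Unshelve. all: by end_near.
Qed.

(** Prolonging the segment from [z] beyond [x0] stays in the affine hull and, for small steps, close
    to [x0]. *)
Lemma relint_extend C x0 z : relint C x0 -> C z ->
  exists2 eps : R, 0 < eps & C (x0 - eps *: (z - x0)).
Proof.
move=> [Cx0 near_x0] Cz.
have : \forall e \near (0 : R)^'+, C (x0 - e *: (z - x0)).
  have : (fun e : R => x0 - e *: (z - x0)) @ 0^'+ --> x0.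
    suff : (fun e : R => x0 - e *: (z - x0)) @ 0^'+ --> x0 - 0 *: (z - x0).
      by rewrite scale0r subr0.
    apply: cvg_at_right_filter; apply: cvgB; first exact: cvg_cst.
    by apply: cvgZr_tmp; exact: cvg_id.
  move=> /(_ _ near_x0) nearC.
  near=> e.
  have : affine_hull C (x0 - e *: (z - x0)) -> C (x0 - e *: (z - x0)).
    by near: e.
  apply; have [j [M [_ _ hullM]]] := affine_hull_basis Cx0.
  apply/hullM; rewrite addrAC subrr sub0r linearN linearZ /= -scaleNr.
  by apply: scalemx_sub; apply/hullM; exact: affine_hull_sub.
move=> nearC.
near (0 : R)^'+ => e.
exists e; first by near: e; exact: nbhs_right_gt.
by near: e.
Unshelve. all: by end_near.
Qed.

End AffineHull.

(** * Ranks and annihilators of row spaces *)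

Section LinearAlgebra.
Context {R : realType} {k : nat}.

Lemma rank_annihilated j (M : 'M[R]_(j, k)) (d : 'cV[R]_k) :
  M *m d = 0 -> d != 0 -> (\rank M < k)%N.
Proof.
move=> Md d0; rewrite ltn_neqAle rank_leq_col andbT; apply/negP => /eqP Mk.
have /submxP[X EX] : (1%:M <= M)%MS by rewrite sub1mx /row_full Mk.
by move/eqP: d0; apply; rewrite -[d]mul1mx EX -mulmxA Md mulmx0.
Qed.

Lemma annihilator_exists j (M : 'M[R]_(j, k)) :
  (\rank M < k)%N -> exists2 d : 'cV[R]_k, d != 0 & M *m d = 0.
Proof.
move=> rM; have /rowV0Pn[v /sub_kermxP vM v0] : kermx M^T != 0.
  by rewrite -mxrank_eq0 mxrank_ker mxrank_tr -lt0n subn_gt0.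
exists v^T; first by rewrite -trmx0 (inj_eq trmx_inj).
by rewrite -[M]trmxK -trmx_mul vM trmx0.
Qed.

Lemma mulmx_rows_eq0 j (M : 'M[R]_(j, k)) (d : 'cV[R]_k) :
  (forall i, dot (row i M)^T d = 0) -> M *m d = 0.
Proof.
move=> Md; apply/row_matrixP => i; rewrite row_mul row0.
by apply/rowP => l; rewrite (ord1 l) -[row i M]trmxK [LHS]Md mxE.
Qed.

Lemma dot_sub_eq0 j (M : 'M[R]_(j, k)) (e d : 'cV[R]_k) :
  (e^T <= M)%MS -> M *m d = 0 -> dot e d = 0.
Proof. by move=> /submxP[X EX] Md; rewrite /dot EX -mulmxA Md mulmx0 mxE. Qed.

End LinearAlgebra.

Lemma card_eq1P (T : Type) (A : set T) : A !=set0 ->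
  (A #= `I_1)%card <-> (forall x y, A x -> A y -> x = y).
Proof.
move=> [a Aa]; split=> [/eq_cardSP[z _ Az]|uniqA]; last first.
  suff -> : A = [set a] by exact: card_set1.
  by apply/seteqP; split=> [x Ax|x ->//]; exact: uniqA.
have {}Az x : A x -> x = z.
  move=> Ax; apply: contrapT => xz; move: Az; rewrite II0 card_eq0 => /eqP Az.
  by suff : set0 x by []; rewrite -Az.
by move=> x y /Az -> /Az ->.
Qed.

(** * Gradients of convex functions *)

Section Gradient.
Context {R : realType} {m : nat}.
Implicit Types (g : 'cV[R]_m -> R) (z d : 'cV[R]_m).

(** The limit is taken from the right because convexity gives estimates for [0 < h < 1]. *)
Lemma gradient_cvg g z d : differentiable g z ->
  h^-1 * (g (z + h *: d) - g z) @[h --> 0^'+] --> dot (gradient g z) d.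
Proof.
move=> dg; have := @diff_derivable _ _ _ _ _ d dg.
rewrite /derivable => /cvg_dnbhs_at_right.
have -> : dot (gradient g z) d = 'D_d g z.
  rewrite dotE (deriveE _ dg) {2}[d]matrix_sum_delta linear_sum.
  apply: eq_bigr => i _; rewrite big_ord1 linearZ /= mxE (deriveE _ dg).
  by rewrite mulrC.
rewrite -[lim _]/('D_d g z); apply: cvg_trans; apply: near_eq_cvg.
by near=> h; rewrite /= [z + _]addrC.
Unshelve. all: by end_near.
Qed.

Lemma gradient_le g z d c : differentiable g z ->
  (forall h, 0 < h < 1 -> g (z + h *: d) - g z <= h * c) ->
  dot (gradient g z) d <= c.
Proof.
move=> dg gc; have Hc := @gradient_cvg g z d dg.
rewrite -(cvg_lim _ Hc); last exact: norm_hausdorff.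
apply: limr_le; first by apply/cvg_ex; eexists; exact: Hc.
near=> h; have h0 : 0 < h by near: h; exact: nbhs_right_gt.
have h1 : h < 1 by near: h; exact: nbhs_right_lt.
by rewrite ler_pdivrMl// gc// h0.
Unshelve. all: by end_near.
Qed.

Lemma gradient_ge g z d c : differentiable g z ->
  (forall h, 0 < h < 1 -> h * c <= g (z + h *: d) - g z) ->
  c <= dot (gradient g z) d.
Proof.
move=> dg gc; have Hc := @gradient_cvg g z d dg.
rewrite -(cvg_lim _ Hc); last exact: norm_hausdorff.
apply: limr_ge; first by apply/cvg_ex; eexists; exact: Hc.
near=> h; have h0 : 0 < h by near: h; exact: nbhs_right_gt.
have h1 : h < 1 by near: h; exact: nbhs_right_lt.
by rewrite ler_pdivlMl// gc// h0.
Unshelve. all: by end_near.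
Qed.

(** Convexity along the segment bounds the difference quotients by [g y - g z]. *)
Lemma gradient_ineq g z y : strictly_convex g -> differentiable g z ->
  g z + dot (gradient g z) (y - z) <= g y.
Proof.
move=> cg dg; rewrite -lerBrDl; apply: gradient_le => // h h01.
have [->|yz] := eqVneq y z; first by rewrite !subrr scaler0 addr0 subrr mulr0.
have := cg y z h yz h01; have -> : h *: y + (1 - h) *: z = z + h *: (y - z).
  by rewrite scalerBl scale1r scalerBr addrCA.
by move=> ?; lra.
Qed.

End Gradient.

(** * Piecewise linear functions and their subdifferentials *)

Section PiecewiseLinear.
Context {R : realType} {n : nat}.
Implicit Types (f : 'cV[R]_n -> \bar R) (x y u : 'cV[R]_n) (t : R).

Lemma dot_col_mx (u x : 'cV[R]_n) (a t : R) :
  dot (col_mx u a%:M) (col_mx x t%:M) = dot u x + a * t.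
Proof.
rewrite /dot tr_col_mx mul_row_col mxE; congr (_ + _).
by rewrite tr_scalar_mx -scalar_mxM mxE mulr1n.
Qed.

Lemma epiE f x t : epi f (col_mx x t%:M) <-> (f x <= t%:E)%E.
Proof. by rewrite /epi /= col_mxKu col_mxKd mxE mulr1n. Qed.

Lemma col_mx_scalarK (p : 'cV[R]_(n + 1)) :
  col_mx (usubmx p) ((dsubmx p 0 0)%:M) = p.
Proof. by rewrite -mx11_scalar vsubmxK. Qed.

(* [s i] is the coefficient of the height; it is nonpositive because epigraphs
   are upward closed, and zero for the facets bounding the domain. *)
Definition epi_system f r (v : 'I_r -> 'cV[R]_n) (s w : 'I_r -> R) :=
  (forall i, s i <= 0) /\
  (forall x t, (f x <= t%:E)%E <-> forall i, dot (v i) x + s i * t <= w i).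

Lemma epi_systemP f : convex_piecewise_linear f -> effective_domain f !=set0 ->
  exists r (v : 'I_r -> 'cV[R]_n) s w, epi_system f v s w.
Proof.
move=> [fNy [r [v [w epiw]]]] [x0 fx0].
have H x t : (f x <= t%:E)%E <->
    forall i, dot (usubmx (v i)) x + dsubmx (v i) 0 0 * t <= w i.
  have E i : dot (v i) (col_mx x t%:M) =
      dot (usubmx (v i)) x + dsubmx (v i) 0 0 * t.
    by rewrite -{1}[v i]col_mx_scalarK dot_col_mx.
  by rewrite -epiE epiw /=; split=> Hi i; have := Hi i; rewrite E.
exists r, (fun i => usubmx (v i)), (fun i => dsubmx (v i) 0 0), w; split=> // i.
have [t0 ft0] : exists t0, (f x0 <= t0%:E)%E.
  move: fx0 (fNy x0); rewrite /effective_domain /=.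
  by case: (f x0) => // t _ _; exists t.
set s := dsubmx (v i) 0 0; set a := dot (usubmx (v i)) x0.
rewrite leNgt; apply/negP => s0.
have bound t : t0 <= t -> a + s * t <= w i.
  move=> t0t; have /H : (f x0 <= t%:E)%E by rewrite (le_trans ft0)// lee_fin.
  exact.
(* [K] is the slack at height [t0]; raising the height by [|K| / s + 1] uses up [|K| + s > K]. *)
set K := w i - a - s * t0.
have : t0 <= t0 + `|K| / s + 1.
  by rewrite -addrA lerDl addr_ge0// divr_ge0// ltW.
move=> /bound; rewrite !mulrDr mulr1 mulrCA divff ?gt_eqF// mulr1.
by have := ler_norm K; rewrite {1}/K; lra.
Qed.

Section AtPoint.
Variables (f : 'cV[R]_n -> \bar R) (r : nat).
Variables (v : 'I_r -> 'cV[R]_n) (s w : 'I_r -> R).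
Hypothesis fNy : forall x, f x != -oo%E.
Hypothesis fsys : epi_system f v s w.

Lemma fin_domain x : (f x < +oo)%E -> exists t, f x = t%:E.
Proof. by move: (fNy x); case: (f x) => // t _ _; exists t. Qed.

Lemma epi_convex x y (a b t : R) : (f x <= a%:E)%E -> (f y <= b%:E)%E ->
  0 <= t <= 1 -> (f (t *: x + (1 - t) *: y) <= (t * a + (1 - t) * b)%:E)%E.
Proof.
move=> /fsys.2 fx /fsys.2 fy /andP[t0 t1]; apply/fsys.2 => i.
have := ler_wpM2l t0 (fx i).
have := ler_wpM2l (_ : 0 <= 1 - t) (fy i); rewrite subr_ge0 => /(_ t1).
by rewrite !dotr; nra.
Qed.

Variables (x0 : 'cV[R]_n) (phi : R).
Hypothesis fx0 : f x0 = phi%:E.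

Lemma subdifferentialP u : subdifferential f x0 u <->
  forall y t, (f y <= t%:E)%E -> phi + dot u (y - x0) <= t.
Proof.
rewrite /subdifferential /= fx0; split=> [fu y t fy|fu y].
  by rewrite -lee_fin EFinD; exact: le_trans (fu y) fy.
have := fNy y; have := fu y; case: (f y) => [t|//|//] fuy _.
  by rewrite -EFinD lee_fin; exact: fuy.
by rewrite leey.
Qed.

(* Horizontal part of the [i]-th facet normal at [(x0, f x0)] once the linear
   function [dot u] is subtracted from [f]; inactive constraints give 0, so that
   Farkas' lemma can be applied to the whole family. *)
Definition slope u i : 'cV[R]_n :=
  if dot (v i) x0 + s i * phi == w i then v i + s i *: u else 0.

(** Slopes are feasible directions of the subdifferential: each grows towards [y] by at most [- s i]
    times the gap [del] between the height [t] and the affine minorant of slope [u]. The total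
    factor [S] dictates the step [(1 + S)^-1]. *)
Lemma subdifferential_slope u (l : 'I_r -> R) :
  subdifferential f x0 u -> (forall i, 0 <= l i) ->
  exists2 eps : R, 0 < eps &
    subdifferential f x0 (u + eps *: \sum_i l i *: slope u i).
Proof.
move=> /subdifferentialP fu l0.
pose S := \sum_i l i * - s i.
have S0 : 0 <= S.
  by apply: sumr_ge0 => i _; rewrite mulr_ge0// oppr_ge0; exact: fsys.1.
exists (1 + S)^-1; first by rewrite invr_gt0 ltr_wpDr.
apply/subdifferentialP => y t fy.
set del := t - phi - dot u (y - x0).
have del0 : 0 <= del by rewrite /del; have := fu _ _ fy; lra.
have slope_le i : dot (slope u i) (y - x0) <= - s i * del.
  rewrite /slope; case: eqP => [act|_]; last first.
    by rewrite dot0l mulr_ge0// oppr_ge0; exact: fsys.1.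
  have /(_ i) := (fsys.2 _ _).1 fy; rewrite -act /del !dotr.
  by lra.
have sum_le : dot (\sum_i l i *: slope u i) (y - x0) <= S * del.
  rewrite dot_suml /S mulr_suml; apply: ler_sum => i _.
  by rewrite dotZl -mulrA ler_wpM2l.
have S1 : 0 < 1 + S by rewrite ltr_wpDr.
have : (1 + S)^-1 * dot (\sum_i l i *: slope u i) (y - x0) <= del.
  rewrite ler_pdivrMl//; apply: le_trans sum_le _.
  by rewrite mulrDl mul1r lerDr.
by rewrite dotDl dotZl /del; lra.
Qed.

(** Active constraints change by [eps * dot (slope u i) y <= 0], and a small step does not exhaust
    the slack of the inactive ones. If [u] is a subgradient at [x0], the moved point lies in its
    contact set. *)
Lemma epi_move u y : (forall i, dot (slope u i) y <= 0) ->
  exists2 eps : R, 0 < eps &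
    (f (x0 + eps *: y) <= (phi + eps * dot u y)%:E)%E.
Proof.
move=> uy.
have near_i : \forall eps \near (0 : R)^'+, forall i,
    dot (v i) (x0 + eps *: y) + s i * (phi + eps * dot u y) <= w i.
  apply: (@filter_forall _ _ (fun i => [set eps |
    dot (v i) (x0 + eps *: y) + s i * (phi + eps * dot u y) <= w i])
    (0 : R)^'+) => i.
  have base : dot (v i) x0 + s i * phi <= w i by apply: (fsys.2 _ _).1; rewrite fx0.
  have := uy i; rewrite /slope; case: eqP => [act uyi|/eqP inact _].
    near=> eps; have e0 : 0 < eps by near: eps; exact: nbhs_right_gt.
    by rewrite /= -act; move: uyi; rewrite !dotr; nra.
  have gap : 0 < w i - (dot (v i) x0 + s i * phi).
    by rewrite subr_gt0 lt_neqAle inact base.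
  set c := dot (v i) y + s i * dot u y.
  near=> eps; have e0 : 0 < eps by near: eps; exact: nbhs_right_gt.
  have : eps < (w i - (dot (v i) x0 + s i * phi)) / (1 + `|c|).
    by near: eps; apply: nbhs_right_lt; rewrite divr_gt0// ltr_wpDr.
  have c1 : 0 < 1 + `|c| by rewrite ltr_wpDr.
  rewrite ltr_pdivlMr// mulrDr mulr1 => He; rewrite /= !dotr.
  have Hc : eps * c <= eps * `|c| by rewrite ler_pM2l// ler_norm.
  by rewrite mulrDr in Hc; lra.
near (0 : R)^'+ => eps.
exists eps; first by near: eps; exact: nbhs_right_gt.
by apply/fsys.2; near: eps.
Unshelve. all: by end_near.
Qed.

(** For a proper closed convex [f], this is the subdifferential at [u] of the conjugate of [f]. *)
Definition contact u : set 'cV[R]_n := [set z | subdifferential f z u].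

Lemma contact_fin u z : contact u z -> exists t, f z = t%:E.
Proof.
move=> /(_ x0); rewrite fx0; move: (fNy z); by case: (f z) => [t|//|//] _; exists t.
Qed.

Lemma contactP u z : contact u x0 ->
  contact u z <-> (f z <= (phi + dot u (z - x0))%:E)%E.
Proof.
move=> ux0; split=> [uz|fz y].
  have [t ft] := contact_fin uz.
  have := uz x0; rewrite fx0 ft -EFinD !lee_fin => H.
  by move: H; rewrite !dotr; lra.
have := ux0 y; rewrite fx0; apply: le_trans.
apply: (@le_trans _ _ ((phi + dot u (z - x0))%:E + (dot u (y - z))%:E))%E.
  by rewrite leeD2r.
by rewrite -!EFinD lee_fin !dotr; lra.
Qed.

Lemma contact_convex u : contact u x0 -> convex_closed (contact u).
Proof.
move=> ux0 x y t /(contactP _ ux0) ux /(contactP _ ux0) uy t01.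
apply/(contactP _ ux0); apply: le_trans (epi_convex ux uy t01) _.
by rewrite lee_fin !dotr; lra.
Qed.

(** The face of the epigraph exposed by [(u, -1)] projects onto the contact set. Its dimension is
    below [n + 1] because this nonzero normal is orthogonal to all its differences. *)
Lemma contact_primal_complex u : contact u x0 -> primal_complex f (contact u).
Proof.
move=> ux0; pose c := col_mx u (-1)%:M : 'cV[R]_(n + 1).
have ux0P := (subdifferentialP u).1 ux0.
set Fbar := epi f `&` [set p | dot c p = dot u x0 - phi].
have inF z : contact u z -> Fbar (col_mx z (phi + dot u (z - x0))%:M).
  move=> /(contactP _ ux0) fz; split; first by apply/epiE.
  by rewrite /= dot_col_mx !dotr; ring.
exists Fbar; last first.
  apply/seteqP; split=> [z uz|_ [p [+ cp] <-]].
    by exists (col_mx z (phi + dot u (z - x0))%:M); [exact: inF|rewrite col_mxKu].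
  rewrite -[p]col_mx_scalarK in cp *; rewrite epiE col_mxKu => fp.
  apply/(contactP _ ux0); apply: le_trans fp _; rewrite lee_fin.
  by move: cp; rewrite /= dot_col_mx !dotr; lra.
split.
- exists c, (dot u x0 - phi); split=> // p.
  rewrite -[p]col_mx_scalarK epiE => /ux0P.
  by rewrite dot_col_mx !dotr; lra.
- by exists (col_mx x0 (phi + dot u (x0 - x0))%:M); exact: inF.
- have Fx0 := inF _ ux0.
  have [j [M [_ FM hullM]]] := affine_hull_basis Fx0.
  rewrite (affine_dim_rank Fx0 hullM) => /eqP; apply/negP.
  rewrite eqz_nat neq_ltn (@rank_annihilated _ _ _ M c)//.
    apply: mulmx_rows_eq0 => i; have [_ /=] := FM i.
    have [_ /= E] := Fx0; rewrite dotDr E -[RHS]addr0 => /addrI.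
    by rewrite dotC.
  apply/eqP => /(congr1 dsubmx); rewrite col_mxKd linear0 => /matrixP/(_ 0 0).
  by rewrite !mxE mulr1n => /eqP; rewrite oppr_eq0 oner_eq0.
Qed.

(** On the contact set [f] is affine with slope [u], so the subgradient [p] makes this linear form
    nonpositive there; prolonging the segment from [z] beyond [x0] gives the opposite sign. *)
Lemma relint_contact_dot u p z : relint (contact u) x0 ->
  subdifferential f x0 p -> contact u z -> dot (p - u) (z - x0) = 0.
Proof.
move=> rx0 /subdifferentialP px0 uz.
have ux0 : contact u x0 by case: rx0.
have [eps e0 /(contactP _ ux0)/px0] := relint_extend rx0 uz.
have /(contactP _ ux0)/px0 := uz.
rewrite !dotr => H1 H2; apply/eqP; rewrite eq_le; apply/andP; split; first by lra.
by rewrite -(pmulr_rge0 _ e0); lra.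
Qed.

Lemma relint_contact_sub u p : relint (contact u) x0 ->
  subdifferential f x0 p -> contact u `<=` contact p.
Proof.
move=> rx0 px0 z uz; have ux0 : contact u x0 by case: rx0.
apply/(contactP _ px0); apply: le_trans ((contactP _ ux0).1 uz) _.
by have := relint_contact_dot rx0 px0 uz; rewrite dotDl dotNl lee_fin; lra.
Qed.

End AtPoint.
End PiecewiseLinear.

(** * Solutions and their dual certificates *)

Section Regression.
Context {R : realType} {m n : nat}.
Variables (D : 'cV[R]_m -> 'cV[R]_m -> R) (A : 'M[R]_(m, n)).
Variable f : 'cV[R]_n -> \bar R.
Hypothesis smoothD : smooth_data_fidelity D.
Hypothesis plf : convex_piecewise_linear f.
Hypothesis dimf : affine_dim (effective_domain f) = n%:Z.

Let fNy := plf.1.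

Lemma domain_nonempty : effective_domain f !=set0.
Proof.
apply/set0P/eqP => dom0; move: dimf; rewrite /affine_dim; case: ifPn => //.
by move=> /asboolP.
Qed.

Lemma row_spaceP (u : 'cV[R]_n) :
  row_space A u <-> exists z, u = A^T *m z.
Proof.
split=> [/submxP[z uz]|[z ->]].
  by exists z^T; rewrite -[u]trmxK uz trmx_mul.
by rewrite /row_space /= trmx_mul trmxK submxMl.
Qed.

Lemma row_space_dot (u d : 'cV[R]_n) : row_space A u -> A *m d = 0 -> dot u d = 0.
Proof. exact: dot_sub_eq0. Qed.

Lemma subdifferential_fin x u : subdifferential f x u -> exists t, f x = t%:E.
Proof.
have [x1 fx1] := domain_nonempty; have [t1 ft1] := fin_domain fNy fx1.
move=> /(_ x1); rewrite ft1; move: (fNy x).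
by case: (f x) => [t|//|//] _; exists t.
Qed.

Lemma solution_fin b x : solution_map D A f b x -> exists t, f x = t%:E.
Proof.
have [x1 fx1] := domain_nonempty; have [t1 ft1] := fin_domain fNy fx1.
move=> /(_ x1); rewrite ft1; move: (fNy x).
by case: (f x) => [t|//|//] _; exists t.
Qed.

Lemma solution_mapP b x phi : f x = phi%:E ->
  solution_map D A f b x <->
  forall y t, (f y <= t%:E)%E -> D (A *m x) b + phi <= D (A *m y) b + t.
Proof.
move=> fx; rewrite /solution_map /= fx; split=> [sx y t fy|sx y].
  rewrite -lee_fin !EFinD; apply: le_trans (sx y) _; exact: leeD2l.
have := fNy y; have := sx y; case: (f y) => [t|//|//] sxy _.
  by rewrite -!EFinD lee_fin; exact: sxy.
by rewrite addey// leey.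
Qed.

(** Fermat's rule. Optimality is tested on the segment from [x] to [y] and differentiated at [x];
    conversely, the tangent inequality of [D ^~ b] is added to the subgradient inequality. *)
Lemma solution_subdifferential b x : (exists t, f x = t%:E) ->
  solution_map D A f b x <->
  subdifferential f x (- (A^T *m gradient (D ^~ b) (A *m x))).
Proof.
move=> [phi fx]; have [scD diffD] := smoothD.1 b.
have [r [v [s [w fsys]]]] := epi_systemP plf domain_nonempty.
rewrite (solution_mapP _ fx) (subdifferentialP fNy fx).
have dotE y : dot (- (A^T *m gradient (D ^~ b) (A *m x))) (y - x) =
    - dot (gradient (D ^~ b) (A *m x)) (A *m y - A *m x).
  by rewrite dotNl dot_mulmxl mulmxBr.
split=> [sx y t fy|sx y t /sx]; rewrite dotE; last first.
  by have := gradient_ineq (A *m y) scD (diffD (A *m x)); lra.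
suff : - (t - phi) <= dot (gradient (D ^~ b) (A *m x)) (A *m y - A *m x) by lra.
apply: gradient_ge => // h /andP[h0 h1].
have fx' : (f x <= phi%:E)%E by rewrite fx.
have h01 : 0 <= h <= 1 by rewrite !ltW.
have /sx := epi_convex fsys fy fx' h01.
have -> : A *m (h *: y + (1 - h) *: x) = A *m x + h *: (A *m y - A *m x).
  by rewrite mulmxDr -!scalemxAr scalerBl scale1r scalerBr addrCA.
by lra.
Qed.

(** Bijectivity of the gradient in [b] provides the data that realize a prescribed gradient at
    [A *m x]. *)
Lemma row_space_solution u x : row_space A u -> subdifferential f x u ->
  exists b, solution_map D A f b x /\ - (A^T *m gradient (D ^~ b) (A *m x)) = u.
Proof.
move=> /row_spaceP[z ->] fu; have [g' _ gK] := smoothD.2 (A *m x).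
have E : - (A^T *m gradient (D ^~ (g' (- z))) (A *m x)) = A^T *m z.
  by rewrite (gK (- z)) mulmxN opprK.
exists (g' (- z)); split=> //; apply/solution_subdifferential.
  exact: subdifferential_fin fu.
by rewrite E.
Qed.

(** Otherwise strict convexity of [D ^~ b] would make the midpoint strictly better. *)
Lemma solution_same_fit b x y : solution_map D A f b x ->
  solution_map D A f b y -> A *m x = A *m y.
Proof.
move=> sx sy; have [phi fx] := solution_fin sx; have [psi fy] := solution_fin sy.
have [r [v [s [w fsys]]]] := epi_systemP plf domain_nonempty.
apply/eqP; apply: contrapT => /negP xy.
have half : 0 < (2^-1 : R) < 1 by apply/andP; split; lra.
have [scD _] := smoothD.1 b.
have := scD (A *m x) (A *m y) 2^-1 xy half.
have half' : 0 <= (2^-1 : R) <= 1 by apply/andP; split; lra.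
have fx' : (f x <= phi%:E)%E by rewrite fx.
have fy' : (f y <= psi%:E)%E by rewrite fy.
have /((solution_mapP b fx).1 sx) := epi_convex fsys fx' fy' half'.
have := (solution_mapP b fx).1 sx _ _ fy'.
have := (solution_mapP b fy).1 sy _ _ fx'.
by rewrite mulmxDr -!scalemxAr; lra.
Qed.

Definition unique_solutions :=
  forall b x y, solution_map D A f b x -> solution_map D A f b y -> x = y.

Lemma unique_codim x u : unique_solutions -> row_space A u ->
  subdifferential f x u ->
  affine_codim (subdifferential f x) <= (\rank A)%:Z.
Proof.
move=> uniq Au fu; have [phi fx] := subdifferential_fin fu.
have [r [v [s [w fsys]]]] := epi_systemP plf domain_nonempty.
have [j [M [_ _ hullM]]] := affine_hull_basis fu.
rewrite /affine_codim (affine_dim_rank fu hullM) lerBlDr -PoszD lez_nat.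
rewrite leqNgt; apply/negP => rMA.
(* The row spaces of [M] and [A] together have dimension below [n], which leaves a direction [d]
   orthogonal to both. *)
have [|d d0 MAd] := @annihilator_exists _ _ _ (M + A)%MS.
  by apply: leq_ltn_trans rMA; rewrite addnC mxrank_adds_leqif.
have Md : M *m d = 0.
  by have /submxP[X ->] := addsmxSl M A; rewrite -mulmxA MAd mulmx0.
have Ad : A *m d = 0.
  by have /submxP[X ->] := addsmxSr M A; rewrite -mulmxA MAd mulmx0.
(* A small step from [u] along one slope stays in the subdifferential, so each slope lies in its
   direction space and is orthogonal to [d]. *)
have slope_d i : dot (slope v s w x phi u i) d <= 0.
  have l0 (k : 'I_r) : 0 <= (k == i)%:R :> R by exact: ler0n.
  have [eps e0] := subdifferential_slope fNy fsys fx fu l0.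
  rewrite (bigD1 i)//= eqxx scale1r big1 ?addr0 => [|k /negPf ->]; last first.
    by rewrite scale0r.
  move=> /affine_hull_sub /hullM; rewrite addrC addKr => /dot_sub_eq0 /(_ Md).
  by rewrite dotZl => /eqP; rewrite mulf_eq0 gt_eqF//= => /eqP ->.
have [eps e0] := epi_move fsys fx slope_d.
rewrite (row_space_dot Au Ad) mulr0 addr0 => fxd.
have [b [sx _]] := row_space_solution Au fu.
have [psi fpsi] : exists t, f (x + eps *: d) = t%:E.
  by apply: (fin_domain fNy); apply: le_lt_trans fxd _; rewrite ltry.
(* The moved point has the same image under [A] and no larger value of [f], so it is a second
   solution. *)
suff /(uniq _ _ _ sx) /eqP : solution_map D A f b (x + eps *: d).
  by rewrite -subr_eq0 opprD addNKr oppr_eq0 scaler_eq0 gt_eqF// (negPf d0).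
apply/(solution_mapP _ fpsi) => y t /((solution_mapP b fx).1 sx).
have -> : A *m (x + eps *: d) = A *m x.
  by rewrite mulmxDr -scalemxAr Ad scaler0 addr0.
by move: fxd; rewrite fpsi lee_fin; lra.
Qed.

End Regression.

(** * Uniqueness from the codimension condition *)

Section Uniqueness.
Context {R : realType} {m n : nat}.
Variables (A : 'M[R]_(m, n)) (f : 'cV[R]_n -> \bar R).
Hypothesis plf : convex_piecewise_linear f.
Hypothesis dimf : affine_dim (effective_domain f) = n%:Z.

Let fNy := plf.1.

(** A line of subgradients forces [e] to be orthogonal to [y - x] for every [y] in the domain, which
    is impossible in full dimension. *)
Lemma subdifferential_no_line x u e : e != 0 ->
  ~ (forall t, subdifferential f x (u + t *: e)).
Proof.
move=> e0 line; have [phi fx] : exists t, f x = t%:E.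
  exact: (subdifferential_fin plf dimf (line 0)).
have dom_e y : effective_domain f y -> dot e (y - x) = 0.
  move=> /(fin_domain fNy)[t ft]; apply/eqP; apply: contrapT => /negP c0.
  have ft' : (f y <= t%:E)%E by rewrite ft.
  (* This parameter makes the subgradient inequality at [y] fail by exactly 1. *)
  pose a := (t - phi - dot u (y - x) + 1) / dot e (y - x).
  have /(subdifferentialP fNy fx)/(_ _ _ ft') := line a.
  by rewrite dotDl dotZl divfK//; lra.
have xdom : effective_domain f x by rewrite /effective_domain /= fx ltry.
have [j [M [_ xM hullM]]] := affine_hull_basis xdom.
move: dimf; rewrite (affine_dim_rank xdom hullM) => -[] rankM.
suff /rank_annihilated/(_ e0) : M *m e = 0 by rewrite rankM ltnn.
apply: mulmx_rows_eq0 => i; rewrite dotC -(dom_e _ (xM i)).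
by rewrite addrC addKr.
Qed.

Lemma subdifferential_convex x : convex_closed (subdifferential f x).
Proof.
move=> u p t fu fp t01; have [phi fx] := subdifferential_fin plf dimf fu.
apply/(subdifferentialP fNy fx) => y a fy.
have := (subdifferentialP fNy fx u).1 fu _ _ fy.
have := (subdifferentialP fNy fx p).1 fp _ _ fy.
by move/andP: t01 => [t0 t1]; rewrite dotDl !dotZl; nra.
Qed.

(** The parameters [t >= 0] that stay in the subdifferential form a closed bounded interval, whose
    supremum is the exit point. *)
Lemma subdifferential_exit x u e p : subdifferential f x u ->
  0 < p -> ~ subdifferential f x (u + p *: e) ->
  exists2 t0, subdifferential f x (u + t0 *: e) &
    forall t, t0 < t -> ~ subdifferential f x (u + t *: e).
Proof.
move=> fu p0 up; have [phi fx] := subdifferential_fin plf dimf fu.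
pose T := [set t | 0 <= t /\ subdifferential f x (u + t *: e)].
have T0 : T 0 by split=> //; rewrite scale0r addr0.
have Tp : ubound T p.
  move=> t [t0 ut]; rewrite leNgt; apply/negP => pt; apply: up.
  have tp : 0 < t by exact: lt_trans pt.
  (* [u + p *: e] lies on the segment from [u] to [u + t *: e], so convexity would keep it
     inside. *)
  have -> : u + p *: e = (p / t) *: (u + t *: e) + (1 - p / t) *: u.
    rewrite scalerDr scalerA divfK ?gt_eqF// addrAC -scalerDl.
    by rewrite [p / t + _]addrC subrK scale1r.
  apply: subdifferential_convex => //; apply/andP; split.
    by rewrite divr_ge0// ltW.
  by rewrite ler_pdivrMr// mul1r ltW.
have supT t : T t -> t <= sup T by apply: ub_le_sup; exists p.
exists (sup T); last first.
  move=> t tT ut; have : T t by split=> //; apply: le_trans (supT _ T0) (ltW tT).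
  by move/supT; rewrite leNgt tT.
apply/(subdifferentialP fNy fx) => y a fy; rewrite dotDl dotZl.
have fu' := (subdifferentialP fNy fx u).1 fu _ _ fy.
(* If [e] does not increase towards [y], the inequality follows from that of [u]; otherwise it is an
   upper bound on [t] and passes to the supremum. *)
have [c0|c0] := leP (dot e (y - x)) 0.
  have : sup T * dot e (y - x) <= 0 by rewrite mulr_ge0_le0// supT.
  by lra.
have : sup T <= (a - phi - dot u (y - x)) / dot e (y - x).
  apply: ge_sup; first by exists 0.
  move=> t [_ /(subdifferentialP fNy fx)/(_ _ _ fy)]; rewrite dotDl dotZl.
  by rewrite ler_pdivlMr//; lra.
by rewrite ler_pdivlMr//; lra.
Qed.

Lemma contact_relint u : contact f u !=set0 ->
  relint (contact f u) (get (relint (contact f u))).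
Proof.
move=> [z uz]; have [phi fz] := subdifferential_fin plf dimf uz.
have [r [v [s [w fsys]]]] := epi_systemP plf (domain_nonempty dimf).
apply: getPex; apply: relint_nonempty; last by exists z.
by move=> y1 y2 t; exact: (contact_convex fNy fsys fz uz).
Qed.

(** Such a [u] certifies non-uniqueness: [z1] and [z2] are solutions for a common [b]. *)
Definition degenerate u := row_space A u /\
  exists z1 z2, [/\ contact f u z1, contact f u z2, A *m z1 = A *m z2 & z1 != z2].

(** Stated for contact sets, so that it follows from either form of the condition, by row space or
    by accessibility. *)
Hypothesis codim_le : forall u, row_space A u -> contact f u !=set0 ->
  affine_codim (face_subdifferential f (contact f u)) <= (\rank A)%:Z.

(* [p] is the last point in the subdifferential on a ray from [u] inside
   [row_space A] and the affine hull of the subdifferential. *)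
Lemma degenerate_step u : degenerate u -> exists p, degenerate p /\
  affine_dim (contact f u) < affine_dim (contact f p).
Proof.
move=> [Au [z1 [z2 [uz1 uz2 Az z12]]]].
have une : contact f u !=set0 by exists z1.
set x0 := get (relint (contact f u)).
have rx0 : relint (contact f u) x0 by exact: contact_relint.
have ux0 : subdifferential f x0 u by case: rx0.
have [phi fx0] := subdifferential_fin plf dimf ux0.
have [r [v [s [w fsys]]]] := epi_systemP plf (domain_nonempty dimf).
have [j [M [_ uM hullM]]] := affine_hull_basis ux0.
have := codim_le Au une; rewrite /affine_codim /face_subdifferential -/x0.
rewrite (affine_dim_rank ux0 hullM) lerBlDr -PoszD lez_nat => rMA.
(* The rows of [M] are differences [p - u] of subgradients at [x0], orthogonal to the contact set of
   [u]. *)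
have Mz z : contact f u z -> M *m (z - x0) = 0.
  move=> uz; apply: mulmx_rows_eq0 => i.
  by rewrite -(relint_contact_dot fNy fx0 rx0 (uM i) uz) [u + _]addrC addrK.
pose d := z1 - z2.
have Md : M *m d = 0.
  have -> : d = (z1 - x0) - (z2 - x0) by rewrite opprB addrA subrK.
  by rewrite mulmxBr !Mz// subrr.
have Ad : A *m d = 0 by rewrite mulmxBr Az subrr.
have rankMA : (\rank (M + A)%MS < n)%N.
  apply: (rank_annihilated (d := d)); last by rewrite subr_eq0.
  have /submxP[X ->] : ((M + A)%MS <= col_mx M A)%MS by rewrite addsmxE.
  by rewrite -mulmxA mul_col_mx Md Ad col_mx0 mulmx0.
(* The ranks of [M] and [A] add up to at least [n], more than the rank of their sum, so the row
   spaces intersect nontrivially. *)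
have /rowV0Pn[e' e'MA e'0] : (M :&: A)%MS != 0.
  rewrite -mxrank_eq0 -lt0n -(ltn_add2l (\rank (M + A)%MS)) mxrank_sum_cap addn0.
  by apply: leq_trans rankMA _; rewrite addnC.
have [e [e0 eM eA [t0 t0e exit_e]]] : exists e, [/\ e != 0, (e^T <= M)%MS,
    row_space A e & exists2 t0, subdifferential f x0 (u + t0 *: e) &
    forall t, t0 < t -> ~ subdifferential f x0 (u + t *: e)].
  have e0 : e'^T != 0 by rewrite -trmx0 (inj_eq trmx_inj).
  have [e'M e'A] : (e' <= M)%MS /\ (e' <= A)%MS.
    by move: e'MA; rewrite sub_capmx => /andP.
  have /existsNP[t ut] := @subdifferential_no_line x0 u _ e0.
  have t0 : t != 0 by apply: contra_notN ut => /eqP ->; rewrite scale0r addr0.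
  (* The sign of [t] decides whether the ray along [e'^T] or the opposite one is followed. *)
  have [tneg|tpos] : t < 0 \/ 0 < t by apply/orP; rewrite -neq_lt.
    exists (- e'^T); split; first by rewrite oppr_eq0.
    - by rewrite -scaleN1r linearZ /= trmxK scalemx_sub.
    - by rewrite /row_space /= -scaleN1r linearZ /= trmxK scalemx_sub.
    apply: (@subdifferential_exit _ _ _ (- t)) => //; first by rewrite oppr_gt0.
    by rewrite scalerN scaleNr opprK.
  exists e'^T; split=> //; rewrite /row_space /= ?trmxK//.
  exact: (@subdifferential_exit _ _ _ t).
pose p := u + t0 *: e.
have Ap : row_space A p.
  by rewrite /row_space /= /p linearD linearZ /= addmx_sub// scalemx_sub.
have sub_up : contact f u `<=` contact f p.
  by move=> z; exact: (relint_contact_sub fNy fx0 rx0 t0e).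
exists p; split; first by split=> //; exists z1, z2; split=> //; exact: sub_up.
(* Without such a [y], Farkas' lemma would make [e] a conic combination of the slopes at [p],
   allowing a step beyond the exit point. *)
have [y slope_y ey] : exists2 y, (forall i, dot (slope v s w x0 phi p i) y <= 0) &
    0 < dot e y.
  apply: contrapT => noy.
  have [y slope_y|l [l0 El]] := @farkas _ _ _ (slope v s w x0 phi p) e.
    by rewrite leNgt; apply/negP => ey; apply: noy; exists y.
  have [eps eps0] := subdifferential_slope fNy fsys fx0 t0e l0.
  rewrite -El /p -addrA -scalerDl; apply: exit_e.
  by rewrite ltrDl.
have px0 : contact f p x0 by exact: t0e.
have [eps eps0 feps] := epi_move fsys fx0 slope_y.
have py : contact f p (x0 + eps *: y).
  apply/(contactP fNy fx0 _ px0).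
  by rewrite [x0 + _ - x0]addrAC subrr add0r dotZr.
have [j1 [N [_ uN hullN]]] := affine_hull_basis (ux0 : contact f u x0).
have [j2 [N' [_ _ hullN']]] := affine_hull_basis px0.
rewrite (affine_dim_rank (ux0 : contact f u x0) hullN).
rewrite (affine_dim_rank px0 hullN') ltz_nat.
apply: rank_ltmx; rewrite ltmxE; apply/andP; split.
  apply/row_subP => i; rewrite -[row i N]trmxK -[(row i N)^T](addKr x0).
  rewrite addrC; apply/hullN'; apply: affine_hull_sub; exact/sub_up/uN.
(* Strictness: [e] is orthogonal to all directions of the contact set of [u], whereas [y] is a
   direction of that of [p] with [0 < dot e y]. *)
apply/negP => N'N.
have yN : (y^T <= N)%MS.
  have /affine_hull_sub/hullN' := py; rewrite [x0 + _]addrC addrK => yN'.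
  have := submx_trans yN' N'N; rewrite linearZ /=.
  by move=> /(scalemx_sub eps^-1); rewrite scalerA mulVf ?gt_eqF// scale1r.
suff Ne : N *m e = 0 by move: ey; rewrite dotC (dot_sub_eq0 yN Ne) ltxx.
apply: mulmx_rows_eq0 => i; rewrite dotC; apply: dot_sub_eq0 eM _.
by rewrite -(Mz _ (uN i)) [x0 + _]addrC addrK.
Qed.

(** Dimensions of contact sets are at most [n], so some degenerate [p] attains the maximal one,
    which a further step would exceed. *)
Lemma no_degenerate u : ~ degenerate u.
Proof.
move=> deg_u.
pose P j := `[< exists p, degenerate p /\ affine_dim (contact f p) = j%:Z >].
have dimP p : degenerate p -> exists2 j : nat,
    affine_dim (contact f p) = j%:Z & (j <= n)%N.
  move=> [_ [z [_ [pz _ _ _]]]].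
  have [j [M [_ _ hullM]]] := affine_hull_basis pz.
  by exists (\rank M); [exact: affine_dim_rank pz hullM|exact: rank_leq_col].
have exP : exists j, P j.
  by have [j uj _] := dimP _ deg_u; exists j; apply/asboolP; exists u.
have Pn j : P j -> (j <= n)%N.
  move=> /asboolP[p [/dimP[j' -> j'n] [<-]]]; exact: j'n.
case: (ex_maxnP exP Pn) => j /asboolP[p [deg_p pj]] jmax.
have [q [deg_q]] := degenerate_step deg_p; have [j' qj' _] := dimP _ deg_q.
rewrite pj qj' ltz_nat ltnNge jmax//; apply/asboolP; by exists q.
Qed.

End Uniqueness.

(** * The equivalence, by row space and by accessibility *)

Lemma primal_complex_convex (R : realType) (n : nat) (f : 'cV[R]_n -> \bar R) F :
  convex_piecewise_linear f -> primal_complex f F -> convex_closed F /\ F !=set0.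
Proof.
move=> [_ [r [v [w epiw]]]] [Fbar [[c [d [_ FE]]] [p Fp] _] ->].
split; last by exists (usubmx p), p.
move=> _ _ t [x Fx <-] [y Fy <-] /andP[t0 t1].
exists (t *: x + (1 - t) *: y); last by rewrite linearD !linearZ.
move: Fx Fy; rewrite FE epiw => -[/= xv cx] [/= yv cy]; split=> [i|] /=.
  by have := xv i; have := yv i; rewrite dotDr !dotZr; nra.
by rewrite dotDr !dotZr cx cy; ring.
Qed.

(** Cardinality one is asserted for nonempty solution sets because a minimizer may fail to exist: on
    the real line, [exp z - b z] with [f = 0] and [A = 1] has none for [b = 0]. *)
Theorem corollary3p2 (R : realType) (m n : nat)
    (D : 'cV[R]_m -> 'cV[R]_m -> R) (A : 'M[R]_(m, n))
    (f : 'cV[R]_n -> \bar R) :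
  smooth_data_fidelity D ->
  convex_piecewise_linear f ->
  affine_dim (effective_domain f) = n%:Z ->
  ((forall b, solution_map D A f b !=set0 ->
      (solution_map D A f b #= `I_1)%card) <->
   (forall F, primal_complex f F ->
      row_space A `&` face_subdifferential f F !=set0 ->
      affine_codim (face_subdifferential f F) <= (\rank A)%:Z))
  /\
  ((forall b, solution_map D A f b !=set0 ->
      (solution_map D A f b #= `I_1)%card) <->
   (forall F, primal_complex f F -> accessible D A f F ->
      affine_codim (face_subdifferential f F) <= (\rank A)%:Z)).
Proof.
move=> smoothD plf dimf; have fNy := plf.1.
have uniqE : (forall b, solution_map D A f b !=set0 ->
    (solution_map D A f b #= `I_1)%card) <-> unique_solutions D A f.
  split=> [card1 b x y sx sy|uniq b sb].
    have sb : solution_map D A f b !=set0 by exists x.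
    exact: (card_eq1P sb).1 (card1 b sb) x y sx sy.
  by apply/(card_eq1P sb) => x y; exact: uniq.
have row_subdifferential b x : solution_map D A f b x ->
    row_space A (- (A^T *m gradient (D ^~ b) (A *m x))) /\
    subdifferential f x (- (A^T *m gradient (D ^~ b) (A *m x))).
  move=> sx; split; first by apply/row_spaceP; eexists; rewrite -mulmxN.
  apply/(solution_subdifferential A smoothD plf dimf b) => //.
  exact: solution_fin sx.
have codimP : unique_solutions D A f -> forall F,
    row_space A `&` face_subdifferential f F !=set0 ->
    affine_codim (face_subdifferential f F) <= (\rank A)%:Z.
  by move=> uniq F [u [Au fu]]; exact: unique_codim smoothD plf dimf _ u uniq Au fu.
have uniqueP : (forall u, row_space A u -> contact f u !=set0 ->
    affine_codim (face_subdifferential f (contact f u)) <= (\rank A)%:Z) ->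
    unique_solutions D A f.
  move=> codim_le b x y sx sy; apply/eqP; apply: contrapT => /negP xy.
  have [Au fu] := row_subdifferential _ _ sx.
  apply: (no_degenerate plf dimf codim_le).
  split; [exact: Au|exists x, y; split=> //].
    have [_ +] := row_subdifferential _ _ sy.
    by rewrite -(solution_same_fit smoothD plf dimf sx sy).
  exact: solution_same_fit sx sy.
have primalP u z : contact f u z -> primal_complex f (contact f u).
  move=> uz; have [phi fz] := subdifferential_fin plf dimf uz.
  exact: (contact_primal_complex fNy fz uz).
rewrite uniqE; split; split.
- by move=> uniq F _; exact: codimP.
(* The chosen relative interior point of the contact set has [u] among its subgradients. *)
- move=> codim_le; apply: uniqueP => u Au une; apply: codim_le.
    by have [z /primalP] := une.
  by exists u; split=> //; have [] := contact_relint plf dimf une.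
(* Accessibility, applied at the chosen relative interior point of [F], yields a subgradient in the
   row space. *)
- move=> uniq F FP Facc; apply: codimP => //.
  have [convF Fne] := primal_complex_convex plf FP.
  have [FrelF _] := getPex (relint_nonempty convF Fne).
  have [b /row_subdifferential[Au fu]] := Facc _ FrelF.
  by eexists; split; [exact: Au|exact: fu].
(* Since [u] is in the row space, every point of its contact set is a solution for some [b]. *)
- move=> codim_le; apply: uniqueP => u Au une; apply: codim_le.
    by have [z /primalP] := une.
  move=> z uz; have [b [sz _]] := row_space_solution smoothD plf dimf Au uz.
  by exists b.
Qed.
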